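(* Let $1<p<\infty$, $s\in(0,1)$, $\Omega=B_1(0)\subset\mathbb{R}^d$ and $\nu(h)=|h|^{-d-sp}$, and let $\widetilde\nu$ be a weight with $\widetilde\nu(h)\asymp(1+|h|)^{-d-sp}$. There exists $g\in L^1(\Omega^c)\setminus L^{p'}(\Omega^c,\widetilde\nu^{\,1-p'})$ compatible with $f=0$, i.e. $\int_{\Omega^c}g(y)\,dy=0$, such that the Neumann problem $Lu=0$ on $\Omega$, $\mathcal{N}u=g$ on $\mathbb{R}^d\setminus\Omega$, does not have a weak solution in $W^p_\nu(\Omega|\mathbb{R}^d)$.
   Context: $\Omega^c=\mathbb{R}^d\setminus\Omega$, $p'=p/(p-1)$, $\psi(t)=|t|^{p-2}t$. The weight is $\widetilde\nu=\widetilde\nu_\Omega$, $\widetilde\nu_\Omega(x)=\int_\Omega\min(1,\nu(x-y))\,dy$, which is comparable from above and below (by positive constants) to $(1+|x|)^{-d-sp}$, and one may take $\widetilde\nu(h)=(1+|h|)^{-d-sp}$. $L^{p'}(\Omega^c,\widetilde\nu^{\,1-p'})$ is the space of measurable $g$ with $\int_{\Omega^c}|g|^{p'}\widetilde\nu^{\,1-p'}dy<\infty$. $W^p_\nu(\Omega|\mathbb{R}^d)$ is the space of measurable $u:\mathbb{R}^d\to\mathbb{R}$ with $u|_\Omega\in L^p(\Omega)$ and $\int_\Omega\int_{\mathbb{R}^d}|u(x)-u(y)|^p\nu(x-y)\,dy\,dx<\infty$. Formally $Lu(x)=2\,\mathrm{p.v.}\int_{\mathbb{R}^d}\psi(u(x)-u(y))\nu(x-y)\,dy$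 and $\mathcal{N}u(y)=2\int_\Omega\psi(u(y)-u(x))\nu(x-y)\,dx$. With $$\mathcal{E}(u,v)=\iint_{(\Omega^c\times\Omega^c)^c}\psi(u(x)-u(y))(v(x)-v(y))\nu(x-y)\,dy\,dx,$$ a weak solution of the Neumann problem $Lu=0$ on $\Omega$, $\mathcal{N}u=g$ on $\mathbb{R}^d\setminus\Omega$, is a function $u\in W^p_\nu(\Omega|\mathbb{R}^d)$ such that $\mathcal{E}(u,v)=\int_{\Omega^c}g(y)v(y)\,dy$ for all $v\in W^p_\nu(\Omega|\mathbb{R}^d)$. *)

(* Defs.v *)
From HB Require Import structures.
From mathcomp Require Import all_boot all_order all_algebra.
From mathcomp Require Import all_classical all_reals all_analysis.

Set Implicit Arguments.
Unset Strict Implicit.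
Unset Printing Implicit Defensive.

Import Order.TTheory GRing.Theory Num.Theory.
Import numFieldNormedType.Exports.

Local Open Scope classical_set_scope.
Local Open Scope ring_scope.

(* Points of the Euclidean space of dimension d. The library equips tuples with
   the product sigma-algebra, so that measurable means Borel measurable. *)
Notation Rn R d := (d.-tuple (measurableTypeR R)).

Section lebesgue_measure_on_tuples.
Context {R : realType}.

Definition tuple_cons (d : nat) (x : measurableTypeR R * Rn R d) : Rn R d.+1 :=
  [tuple of x.1 :: x.2].

Lemma measurable_tuple_cons d : measurable_fun setT (@tuple_cons d).
Proof. exact: measurable_cons. Qed.

Lemma measurable_tuple_split d : measurable_fun setT
  (fun x : Rn R d.+1 => (thead x, [tuple of behead x])).
Proof.
apply/measurable_fun_pair => /=; first exact: measurable_tnth.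
exact: measurable_behead.
Qed.

Section step.
Variables (d : nat) (mu : {sigma_finite_measure set (Rn R d) -> \bar R}).

Definition lebesgue_step : set (Rn R d.+1) -> \bar R :=
  pushforward (lebesgue_measure \x mu)%E (@tuple_cons d).

Let lebesgue_step0 : lebesgue_step set0 = 0%E.
Proof. by rewrite /lebesgue_step /pushforward preimage_set0 measure0. Qed.

Let lebesgue_step_ge0 A : (0 <= lebesgue_step A)%E.
Proof. by rewrite /lebesgue_step /pushforward; exact: measure_ge0. Qed.

Let lebesgue_step_sigma_additive : semi_sigma_additive lebesgue_step.
Proof.
rewrite /lebesgue_step; apply: measure_semi_sigma_additive.
Unshelve.
exact: measurable_tuple_cons.
Qed.

HB.instance Definition _ := isMeasure.Build _ _ _ lebesgue_step
  lebesgue_step0 lebesgue_step_ge0 lebesgue_step_sigma_additive.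

Lemma lebesgue_step_sigma_finite : sigma_finite setT lebesgue_step.
Proof.
have /sigma_finiteP[F [TF ndF Foo]] := sigma_finiteT (@lebesgue_measure R).
have /sigma_finiteP[G [TG ndG Goo]] := sigma_finiteT mu.
pose split (x : Rn R d.+1) : measurableTypeR R * Rn R d :=
  (thead x, [tuple of behead x]).
have splitK : cancel (@tuple_cons d) split.
  move=> [a t]; rewrite /split /tuple_cons /= theadE.
  by congr pair; apply: val_inj.
exists (fun k => split @^-1` (F k `*` G k)).
  apply/esym/seteqP; split => // x _ /=.
  have [n _ Fn] : (\bigcup_n F n) (split x).1 by rewrite -TF.
  have [m _ Gm] : (\bigcup_n G n) (split x).2 by rewrite -TG.
  exists (maxn n m) => //; split.
  - by move: Fn; exact/subsetPset/ndF/leq_maxl.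
  - by move: Gm; exact/subsetPset/ndG/leq_maxr.
move=> k; have [mFk Fk] := Foo k; have [mGk Gk] := Goo k; split.
  rewrite -[X in measurable X]setTI.
  by apply: measurable_tuple_split => //; exact: measurableX.
rewrite /lebesgue_step /pushforward (_ : _ @^-1` _ = F k `*` G k).
  by rewrite product_measure1E// lte_mul_pinfty// ge0_fin_numE.
by rewrite -comp_preimage (_ : split \o _ = id)//; apply/funext.
Qed.

HB.instance Definition _ :=
  @Measure_isSigmaFinite.Build _ _ _ lebesgue_step lebesgue_step_sigma_finite.

Definition lebesgue_stepS : {sigma_finite_measure set (Rn R d.+1) -> \bar R} :=
  lebesgue_step.

End step.

Definition lebesgue0 : {sigma_finite_measure set (Rn R 0) -> \bar R} :=
  dirac ([tuple] : Rn R 0).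

(* d-dimensional Lebesgue measure, as the d-fold product of lebesgue_measure
   (a unit point mass when d = 0). *)
Fixpoint lebesgue_Rn (d : nat) : {sigma_finite_measure set (Rn R d) -> \bar R} :=
  if d is d'.+1 then lebesgue_stepS (lebesgue_Rn d') else lebesgue0.

Lemma lebesgue_Rn_box (d : nat) (A : 'I_d -> set (measurableTypeR R)) :
  (forall i, measurable (A i)) ->
  lebesgue_Rn d [set x | forall i, A i (tnth x i)] =
  (\prod_(i < d) lebesgue_measure (A i))%E.
Proof.
elim: d A => [|d IH] A mA.
  rewrite big_ord0 /= diracE (_ : _ \in _)//.
  by apply/mem_set => -[].
rewrite big_ord_recl -(IH (fun i => A (lift ord0 i)))//.
rewrite -product_measure1E//; last first.
  rewrite (_ : mkset _ = \bigcap_(i in [set: 'I_d])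
    ((@tnth _ (measurableTypeR R))^~ i @^-1` A (lift ord0 i))).
    apply: fin_bigcap_measurable => // i _; rewrite -[X in measurable X]setTI.
    exact: measurable_tnth.
  by apply/seteqP; split => x /= H i; [move=> _|]; exact: H.
rewrite /= /lebesgue_step /pushforward; congr (_ _).
apply/seteqP; split => -[a t] /=.
  move=> H; split; first exact: (H ord0).
  by move=> i; have := H (lift ord0 i); rewrite /tuple_cons tnthS.
move=> [Aa H] i; case: (unliftP ord0 i) => [j|] ->; last exact: Aa.
by rewrite /tuple_cons tnthS; exact: H.
Qed.

End lebesgue_measure_on_tuples.
Arguments lebesgue_Rn {R} d.

Section nonlocal_neumann.
Context {R : realType} {d : nat}.
Implicit Types (p s q : R) (Omega A : set (Rn R d)) (nu w f g u v : Rn R d -> R).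

Definition tsub (x y : Rn R d) : Rn R d := [tuple tnth x i - tnth y i | i < d].

Definition enorm (x : Rn R d) : R := Num.sqrt (\sum_(i < d) tnth x i ^+ 2).

Definition unit_ball : set (Rn R d) := [set x | enorm x < 1].

Definition frac_kernel s p : Rn R d -> R :=
  fun h => enorm h `^ (- d%:R - s * p).

(* f is comparable to g from above and below. *)
Definition asymp f g :=
  exists c C : R, [/\ 0 < c, 0 < C & forall x, c * g x <= f x <= C * g x].

Definition conjugate_exponent p : R := p / (p - 1).

(* Membership in the weighted space L^q(A, w). *)
Definition in_Lq q A w g :=
  measurable_fun A g /\
  (\int[lebesgue_Rn d]_(y in A) (`|g y| `^ q * w y)%:E < +oo)%E.

Definition psi p (t : R) : R := `|t| `^ (p - 2) * t.

(* The space W^p_nu(Omega | R^d). *)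
Definition in_W p nu Omega u :=
  [/\ measurable_fun setT u,
      (\int[lebesgue_Rn d]_(x in Omega) (`|u x| `^ p)%:E < +oo)%E &
      (\int[lebesgue_Rn d]_(x in Omega) \int[lebesgue_Rn d]_y
         (`|u x - u y| `^ p * nu (tsub x y))%:E < +oo)%E].

Definition energy p nu Omega u v : \bar R :=
  \int[(lebesgue_Rn d \x lebesgue_Rn d)%E]_(z in ~` (~` Omega `*` ~` Omega))
    (psi p (u z.1 - u z.2) * (v z.1 - v z.2) * nu (tsub z.1 z.2))%:E.

(* Weak solutions of L u = 0 on Omega, N u = g on the complement of Omega. The
   equation is between extended reals; the left-hand side is finite for u, v in
   W^p_nu(Omega | R^d) by Hoelder's inequality, so the equation includes the
   integrability of g * v: the library's integral of a measurable function is
   infinite when the function is not integrable. *)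
Definition neumann_weak_solution p nu Omega g u :=
  in_W p nu Omega u /\
  forall v, in_W p nu Omega v ->
    energy p nu Omega u v =
    (\int[lebesgue_Rn d]_(y in ~` Omega) (g y * v y)%:E)%E.

End nonlocal_neumann.

(* Main.v *)
Require Import Defs.
From mathcomp Require Import all_boot all_order all_algebra ring lra.
From mathcomp Require Import all_classical all_reals all_analysis.
From mathcomp Require Import measurable_realfun.
Import Order.TTheory GRing.Theory Num.Theory.
Import numFieldNormedType.Exports.
Local Open Scope classical_set_scope.
Local Open Scope ring_scope.

(** The datum g is a function with a power singularity on a hyperplane at
    positive distance from the ball, so strong that g v is not integrable for
    some admissible test function v.

    Away from the closure of Omega the kernel nu(x - y), x in Omega, is bounded.
    A function v supported on a bounded set at positive distance from Omega
    hence belongs to W^p_nu(Omega | R^d) as soon as it is in L^p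
    ([in_W_singular]): it vanishes on Omega, and the p-th power of its
    seminorm is at most a constant times the measure of Omega times the p-th
    power of its L^p norm. Write [singular a] for the function (y_0 - 2)^(-a)
    on the bounded box 2 < y_0 <= 3, 0 <= y_i <= 1, extended by zero. Its
    integral is finite for 0 <= a < 1 ([integral_singular_lty]) and infinite
    for a = 1 ([integral_singular1]).

    With a = 1/(2p) and b = 1 - a, the function v = [singular a] has
    v^p = [singular (1/2)], so it is a legitimate test function, while
    [singular b] is integrable and [singular b] * v = [singular 1] is not.
    Take g to be [singular b] corrected by a constant multiple of the indicator
    of another box, on which v vanishes, so that g has mean zero. Since
    b p' >= 1 and the weight nut^(1-p') is bounded below by a positive constant,
    g is not in the weighted L^p' space. For a weak solution u the number
    E(u, v) would be the integral of g v, which is infinite; but E(u, v) is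
    always finite for u, v in W^p_nu ([energy_fin_num]), because
    |psi(a) b| <= |a|^p + |b|^p and the domain of integration is the union of
    Omega x R^d and part of its mirror image R^d x Omega. *)

(** * Boxes and dyadic intervals *)

Lemma measurable_box (R : realType) d (A : 'I_d -> set (measurableTypeR R)) :
  (forall i, measurable (A i)) ->
  measurable [set x : Rn R d | forall i, A i (tnth x i)].
Proof.
move=> mA; rewrite (_ : mkset _ = \bigcap_(i in [set: 'I_d])
    ((@tnth _ (measurableTypeR R))^~ i @^-1` A i)).
  apply: fin_bigcap_measurable => // i _; rewrite -[X in measurable X]setTI.
  by apply: measurable_tnth => //; exact: mA.
by apply/seteqP; split => x /= H i; [move=> _|]; exact: H.
Qed.

Section slabs.
Context {R : realType} {n : nat}.
Implicit Types I : set R.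

(** The coordinates other than the first are confined to the unit interval, so
    that the volume of a slab is the length of its first projection. *)
Definition slab I : set (Rn R n.+1) :=
  [set x | I (thead x) /\ forall i, tnth x (lift ord0 i) \in `[0, 1]].

Lemma slabE I : slab I =
  [set x | forall i, (if i == ord0 then I else [set` `[0, 1]]) (tnth x i)].
Proof.
apply/seteqP; split=> x /=.
  move=> [Ix x01] i; case: (unliftP ord0 i) => [j|] -> /=; last exact: Ix.
  exact: x01.
by move=> H; split=> [|i]; [exact: (H ord0) | exact: (H (lift ord0 i))].
Qed.

Lemma measurable_slab I : measurable I -> measurable (slab I).
Proof.
move=> mI; rewrite slabE.
apply: (@measurable_box R n.+1 (fun i => if i == ord0 then I else _)) => i.
by case: ifP.
Qed.

Lemma lebesgue_slab I : measurable I ->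
  lebesgue_Rn n.+1 (slab I) = lebesgue_measure I.
Proof.
move=> mI; rewrite slabE.
rewrite (@lebesgue_Rn_box R n.+1
  (fun i => if i == ord0 then I else [set` `[0, 1]])).
  rewrite big_ord_recl eqxx big1 ?mule1// => i _.
  rewrite (_ : (lift ord0 i == ord0) = false)// lebesgue_measure_itv /=.
  by rewrite lte_fin ltr01 oppr0 adde0.
by move=> i; case: ifP.
Qed.

End slabs.

Section dyadic.
Context {R : realType}.

(** Dyadic pieces of the interval from 2 to 3, shrinking towards 2: on the k-th
    piece t - 2 is within a factor two of its length 2^-(k+1). *)
Definition dyadic (k : nat) : set R :=
  `]2 + 2^-1 ^+ k.+1, 2 + 2^-1 ^+ k]%classic.

Lemma half_pow_gt0 k : 0 < 2^-1 ^+ k :> R.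
Proof. by rewrite exprn_gt0// invr_gt0. Qed.

Lemma half_pow_le (j k : nat) : (j <= k)%N -> 2^-1 ^+ k <= 2^-1 ^+ j :> R.
Proof.
by move=> jk; apply: ler_wiXn2l => //; rewrite invf_le1// ler1n.
Qed.

Lemma bigcup_dyadic : \bigcup_k dyadic k = `]2, 3]%classic.
Proof.
apply/seteqP; split=> t.
  rewrite /dyadic => -[k _]; rewrite /= !in_itv/= => /andP[lo hi].
  rewrite (lt_trans _ lo) ?ltrDl ?half_pow_gt0//= (le_trans hi)//.
  have := @half_pow_le 0 k isT; rewrite expr0; lra.
rewrite /= in_itv/= => /andP[lo hi].
have t0 : 0 < t - 2 by rewrite subr_gt0.
have [k hk] : exists k, 2^-1 ^+ k < t - 2.
  have half_lt1 : `|2^-1 : R| < 1.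
    by rewrite ger0_norm ?invr_ge0// invf_lt1// ltr1n.
  have /cvgrPdist_lt/(_ _ t0)[k _ /(_ k (leqnn k))] := cvg_expr half_lt1.
  by rewrite sub0r normrN ger0_norm ?ltW ?half_pow_gt0//; exists k.
have ex : exists k, 2^-1 ^+ k < t - 2 by exists k.
(* the first power of 1/2 below t - 2 has a predecessor because t - 2 <= 1 *)
case: (ex_minnP ex) => -[|m] hm min.
  by move: hm; rewrite expr0; lra.
exists m => //; rewrite /dyadic /= in_itv/= addrC -ltrBrDr hm/= addrC -lerBlDr.
by rewrite leNgt; apply/negP => /min; rewrite ltnn.
Qed.

Lemma trivIset_dyadic : trivIset setT dyadic.
Proof.
apply: ltn_trivIset => k j jk; apply/seteqP; split=> // t [].
rewrite /dyadic /= !in_itv /= => /andP[lo _] /andP[_ hi].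
have := half_pow_le _ _ jk.
by move: lo hi; lra.
Qed.

Lemma lebesgue_dyadic k : lebesgue_measure (dyadic k) = (2^-1 ^+ k.+1)%:E.
Proof.
rewrite lebesgue_measure_itv /= lte_fin.
have h := half_pow_gt0 k.
have e : 2^-1 ^+ k.+1 = 2^-1 * 2^-1 ^+ k :> R by rewrite exprS.
rewrite ifT; last by lra.
by congr EFin; lra.
Qed.

End dyadic.

(** * Power singularities on a hyperplane *)

Lemma powR_exprn (R : realType) (x b : R) k : 0 <= x ->
  (x ^+ k) `^ b = (x `^ b) ^+ k.
Proof. by move=> x0; rewrite -powR_mulrn// powRAC powR_mulrn// powR_ge0. Qed.

Section singular.
Context {R : realType} {n : nat}.
Implicit Types (a b r : R) (D : set (Rn R n.+1)).
Local Notation mu := (@lebesgue_Rn R n.+1).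

Definition power_at2 a (y : Rn R n.+1) : R := (thead y - 2) `^ (- a).

(** The test function, the datum and their product are all of this form, and
    products and powers act on the exponent alone ([singularM],
    [singular_powR]). *)
Definition singular a (y : Rn R n.+1) : R :=
  \1_(slab `]2, 3]) y * power_at2 a y.

Lemma measurable_power_at2 a D : measurable_fun D (power_at2 a).
Proof.
apply: measurable_funTS; apply: (measurableT_comp (measurable_powR _)).
by apply: measurable_funB => //; exact: measurable_tnth.
Qed.

Lemma measurable_singular a D : measurable_fun D (singular a).
Proof.
apply: measurable_funM; last exact: measurable_power_at2.
by apply: measurable_funTS; apply: measurable_indic; exact: measurable_slab.
Qed.

Lemma singular_ge0 a y : 0 <= singular a y.
Proof. by rewrite mulr_ge0// powR_ge0. Qed.

Lemma singular_out a y : ~ slab `]2, 3]%classic y -> singular a y = 0.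
Proof. by move=> yA; rewrite /singular indicE memNset ?mul0r. Qed.

Lemma singularM a b y : singular a y * singular b y = singular (a + b) y.
Proof.
rewrite /singular indicE;
  case: (boolP (y \in slab _)); rewrite ?mul0r// !mul1r => /set_mem[].
rewrite /= in_itv/= => /andP[y2 _] _; rewrite /power_at2 -powRD -?opprD//.
by rewrite subr_eq0 (gt_eqF y2) implybT.
Qed.

Lemma singular_powR a r y : r != 0 -> singular a y `^ r = singular (a * r) y.
Proof.
move=> r0; rewrite /singular indicE;
  case: (boolP (y \in slab _)); rewrite ?mul0r ?powR0// !mul1r.
by rewrite /power_at2 -powRrM mulNr.
Qed.

Lemma le_singular a b y : a <= b -> singular a y <= singular b y.
Proof.
move=> ab; rewrite /singular indicE;
  case: (boolP (y \in slab _)); rewrite ?mul0r// !mul1r.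
move=> /set_mem[]; rewrite /= in_itv/= => /andP[lo hi] _.
by apply: ger_powR; rewrite ?lerN2//; lra.
Qed.

Lemma integral_singular_dyadic a D : measurable D -> slab `]2, 3] `<=` D ->
  (\int[mu]_(y in D) (singular a y)%:E =
   \sum_(k <oo) \int[mu]_(y in slab (dyadic k)) (power_at2 a y)%:E)%E.
Proof.
move=> mD AD.
transitivity (\int[mu]_(y in slab `]2%R, 3%R]) (power_at2 a y)%:E)%E.
  rewrite integral_mkcond [RHS]integral_mkcond; apply: eq_integral => y _.
  rewrite !patchE /singular indicE.
  have [yA|yA] := boolP (y \in slab _); last by rewrite mul0r if_same.
  by rewrite mul1r ifT//; apply/mem_set/AD/set_mem.
have -> : slab `]2, 3] = \bigcup_k slab (dyadic k) :> set (Rn R n.+1).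
  rewrite -bigcup_dyadic; apply/seteqP; split=> y /=.
    by move=> [[k _ yk] y01]; exists k.
  by move=> [k _ [yk y01]]; split=> //; exists k.
rewrite ge0_integral_bigcup//.
- by move=> k; apply: measurable_slab; exact: measurable_itv.
- by apply/measurable_EFinP; exact: measurable_power_at2.
- by move=> y _; rewrite lee_fin powR_ge0.
- move=> i j _ _ [y [[yi _] [yj _]]].
  by apply: (@trivIset_dyadic R) => //; exists (thead y).
Qed.

(** On the k-th dyadic piece the integrand is at most 2^((k+1)a), and the piece
    has measure 2^-(k+1): the integral is dominated by a geometric series of
    ratio 2^(a-1) < 1. *)
Lemma integral_singular_lty a D : measurable D -> slab `]2, 3] `<=` D ->
  0 <= a < 1 -> (\int[mu]_(y in D) (singular a y)%:E < +oo)%E.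
Proof.
move=> mD AD /andP[a0 a1]; rewrite integral_singular_dyadic//.
set z : R := 2^-1 `^ (1 - a).
have z0 : 0 < z by rewrite powR_gt0.
have z1 : z < 1.
  have : z < 1 `^ (1 - a).
    by rewrite gt0_ltr_powR// ?nnegrE ?subr_gt0// invf_lt1// ltr1n.
  by rewrite powR1.
apply: (@le_lt_trans _ _ (z / (1 - z))%:E); last by rewrite ltry.
apply: (@le_trans _ _ (\sum_(k <oo) (geometric z z k)%:E)%E).
  apply: lee_nneseries => [k _ _|k _].
    by apply: integral_ge0 => y _; rewrite lee_fin powR_ge0.
  have -> : (geometric z z k)%:E =
      (\int[mu]_(y in slab (dyadic k)) (cst ((2^-1 ^+ k.+1) `^ (- a))%:E) y)%E.
    rewrite integral_cst ?[X in (_ * X)%E]lebesgue_slab ?lebesgue_dyadic;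
      try exact: measurable_itv.
      rewrite -EFinM; congr EFin.
      have q0 := @half_pow_gt0 R k.+1.
      rewrite /= -exprS -[X in _ = _ * X](powRr1 (ltW q0)).
      rewrite -powRD ?(gt_eqF q0) ?implybT// addrC.
      by rewrite powR_exprn ?invr_ge0.
    by apply: measurable_slab; exact: measurable_itv.
  apply: ge0_le_integral => //.
  - by apply: measurable_slab; exact: measurable_itv.
  - by move=> y _; rewrite lee_fin powR_ge0.
  - by apply/measurable_EFinP; exact: measurable_power_at2.
  move=> y [+ _]; rewrite /dyadic /= in_itv/= => /andP[lo hi].
  have h := @half_pow_gt0 R k.+1.
  rewrite lee_fin /power_at2 !powRN lef_pV2 ?posrE ?powR_gt0//; last by lra.
  by apply: ge0_ler_powR; rewrite ?nnegrE//; lra.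
apply: lime_le.
  by apply: is_cvg_nneseries => k _ _; rewrite lee_fin geometric_ge0// ltW.
apply: nearW => k; rewrite sumEFin lee_fin.
apply: geometric_le_lim => //; first exact: ltW.
by rewrite gtr0_norm.
Qed.

(** Every dyadic piece contributes at least 1/2. *)
Lemma integral_singular1 D : measurable D -> slab `]2, 3] `<=` D ->
  (\int[mu]_(y in D) (singular 1 y)%:E = +oo)%E.
Proof.
move=> mD AD; rewrite integral_singular_dyadic//; apply: eq_infty => r.
set N := Num.bound `|r * 2|.
apply: (@le_trans _ _ (\sum_(0 <= k < N) 2^-1%:E)%E).
  rewrite sumEFin lee_fin sumr_const_nat subn0 -mulr_natr.
  have := archi_boundP (normr_ge0 (r * 2)); have := ler_norm (r * 2).
  by rewrite -/N; lra.
apply: (@le_trans _ _ (\sum_(k <oo) 2^-1%:E)%E).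
  by apply: nneseries_lim_ge => k _ _; rewrite lee_fin invr_ge0.
apply: lee_nneseries => [k _ _|k _]; first by rewrite lee_fin invr_ge0.
have h := @half_pow_gt0 R k.
have -> : 2^-1%:E =
    (\int[mu]_(y in slab (dyadic k)) (cst ((2^-1 ^+ k)^-1)%:E) y)%E.
  rewrite integral_cst ?[X in (_ * X)%E]lebesgue_slab ?lebesgue_dyadic;
    try exact: measurable_itv.
    by rewrite -EFinM exprSr mulKf// gt_eqF.
  by apply: measurable_slab; exact: measurable_itv.
apply: ge0_le_integral => //.
- by apply: measurable_slab; exact: measurable_itv.
- by move=> y _; rewrite lee_fin invr_ge0 ltW.
- by apply/measurable_EFinP; exact: measurable_power_at2.
move=> y [+ _]; rewrite /dyadic /= in_itv/= => /andP[lo hi].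
have h1 := @half_pow_gt0 R k.+1.
by rewrite lee_fin /power_at2 powR_inv1 ?lef_pV2 ?posrE; lra.
Qed.

End singular.

(** * Euclidean norm and kernel *)

Section euclidean.
Context {R : realType} {d : nat}.
Local Notation mu := (@lebesgue_Rn R d).

Lemma measurable_tsub :
  measurable_fun setT (fun z : Rn R d * Rn R d => tsub z.1 z.2).
Proof.
apply/measurable_fun_tnthP => i.
rewrite (_ : _ \o _ = fun z => tnth z.1 i - tnth z.2 i); last first.
  by apply/funext => z; rewrite /= /tsub tnth_mktuple.
by apply: measurable_funB; apply: (measurableT_comp (measurable_tnth i)).
Qed.

(** Turns the measurability of the norm into that of a real power. *)
Lemma enorm_powR (x : Rn R d) : enorm x = (\sum_(i < d) tnth x i ^+ 2) `^ 2^-1.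
Proof. by rewrite powR12_sqrt// sumr_ge0// => i _; rewrite sqr_ge0. Qed.

Lemma measurable_enorm : measurable_fun setT (@enorm R d).
Proof.
rewrite (funext enorm_powR).
apply: (measurableT_comp (measurable_powR _)).
apply: measurable_sum => i; apply: measurable_funX; exact: measurable_tnth.
Qed.

Lemma enorm_ge_coord (x : Rn R d) i : `|tnth x i| <= enorm x.
Proof.
rewrite -sqrtr_sqr /enorm ler_wsqrtr// (bigD1 i)//= lerDl sumr_ge0// => j _.
exact: sqr_ge0.
Qed.

Lemma enorm_tsubC (x y : Rn R d) : enorm (tsub x y) = enorm (tsub y x).
Proof.
congr Num.sqrt; apply: eq_bigr => i _.
by rewrite /tsub !tnth_mktuple -sqrrN opprB.
Qed.

Lemma measurable_unit_ball : measurable (@unit_ball R d).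
Proof.
rewrite -[X in measurable X]setTI (_ : unit_ball = enorm @^-1` `]-oo, 1[).
  by apply: measurable_enorm => //; exact: measurable_itv.
by apply/seteqP; split=> x /=; rewrite in_itv.
Qed.

(** The ball lies in the cube of side 2. *)
Lemma lebesgue_unit_ball_lty : (mu unit_ball < +oo)%E.
Proof.
pose A := fun _ : 'I_d => [set` `[-1, 1 : R]].
have mA i : measurable (A i) by exact: measurable_itv.
have mbox : measurable [set x : Rn R d | forall i, A i (tnth x i)].
  exact: measurable_box.
apply: (@le_lt_trans _ _ (mu [set x | forall i, A i (tnth x i)])).
  apply: le_measure; rewrite ?inE//; first exact: measurable_unit_ball.
  move=> x; rewrite /unit_ball /A /= => x1 i.
  by rewrite in_itv/= -ler_norml (le_trans (enorm_ge_coord x i))// ltW.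
rewrite lebesgue_Rn_box// -ge0_fin_numE; last first.
  by elim/big_ind: _ => // x y; exact: mule_ge0.
elim/big_ind: _ => //; first by move=> x y; exact: fin_numM.
by move=> i _; rewrite lebesgue_measure_itv/=; case: ifP.
Qed.

Lemma measurable_frac_kernel (s p : R) :
  measurable_fun setT (@frac_kernel R d s p).
Proof.
by apply: (measurableT_comp (measurable_powR _)); exact: measurable_enorm.
Qed.

Lemma frac_kernel_ge0 (s p : R) (h : Rn R d) : 0 <= frac_kernel s p h.
Proof. exact: powR_ge0. Qed.

End euclidean.

(** * Finiteness of the energy form *)

Section energy_finite.
Context {R : realType} {d : nat}.
Variables (p : R) (nu : Rn R d -> R) (Omega : set (Rn R d)).
Hypotheses (p1 : 1 < p) (mnu : measurable_fun setT nu)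
  (nu0 : forall h, 0 <= nu h)
  (nuC : forall x y, nu (tsub x y) = nu (tsub y x)) (mOmega : measurable Omega).
Implicit Types u v : Rn R d -> R.
Local Notation mu := (@lebesgue_Rn R d).

(** A crude Young inequality, enough to replace Hoelder's: both |a|^(p-1) and
    |b| are bounded by powers of the larger of |a| and |b|. *)
Lemma psi_young (a b : R) : `|psi p a * b| <= `|a| `^ p + `|b| `^ p.
Proof.
have gt1 := p1; have p0 : 0 < p by lra.
rewrite normrM.
have -> : `|psi p a| = `|a| `^ (p - 1).
  have [->|a0] := eqVneq a 0.
    by rewrite /psi mulr0 normr0 powR0// subr_eq0 gt_eqF.
  rewrite /psi normrM ger0_norm ?powR_ge0// -[X in _ * X]powRr1//.
  rewrite -powRD; first by congr (_ `^ _); lra.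
  by rewrite normr_eq0 a0 implybT.
have pow_split (c : R) : `|c| `^ p = `|c| `^ (p - 1) * `|c|.
  by rewrite mulrC mulr_powRB1.
have [ab|/ltW ba] := lerP `|a| `|b|.
  apply: (@le_trans _ _ (`|b| `^ p)); last by rewrite lerDr powR_ge0.
  by rewrite pow_split ler_wpM2r// ge0_ler_powR ?nnegrE ?subr_ge0 ?(ltW p1).
apply: (@le_trans _ _ (`|a| `^ p)); last by rewrite lerDl powR_ge0.
by rewrite pow_split ler_wpM2l// powR_ge0.
Qed.

Definition gagliardo u (z : Rn R d * Rn R d) : \bar R :=
  (`|u z.1 - u z.2| `^ p * nu (tsub z.1 z.2))%:E.

Lemma gagliardo_ge0 u z : (0 <= gagliardo u z)%E.
Proof. by rewrite lee_fin mulr_ge0// powR_ge0. Qed.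

Lemma measurable_kernel : measurable_fun setT
  (fun z : Rn R d * Rn R d => nu (tsub z.1 z.2)).
Proof. apply: (measurableT_comp mnu); exact: measurable_tsub. Qed.

Lemma measurable_diff u : measurable_fun setT u -> measurable_fun setT
  (fun z : Rn R d * Rn R d => u z.1 - u z.2).
Proof. by move=> mf; apply: measurable_funB; exact: measurableT_comp. Qed.

Lemma measurable_gagliardo u : measurable_fun setT u ->
  measurable_fun setT (gagliardo u).
Proof.
move=> mf; apply/measurable_EFinP.
apply: measurable_funM; last exact: measurable_kernel.
apply: (measurableT_comp (measurable_powR _)).
by apply: (measurableT_comp (@normr_measurable _ _)); exact: measurable_diff.
Qed.

Lemma integral_gagliardo_left u : measurable_fun setT u ->
  (\int[mu \x mu]_(z in Omega `*` setT) gagliardo u z =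
   \int[mu]_(x in Omega) \int[mu]_y gagliardo u (x, y))%E.
Proof.
move=> mf; rewrite integral_mkcond.
rewrite fubini_tonelli1; first last.
- by move=> z; rewrite patchE; case: ifP => // _; exact: gagliardo_ge0.
- apply/(measurable_restrictT _ _).1; first exact: measurableX.
  by apply: measurable_funTS; exact: measurable_gagliardo.
rewrite [RHS]integral_mkcond; apply: eq_integral => x _.
rewrite /fubini_F patchE; case: ifPn => xO.
  apply: eq_integral => y _; rewrite patchE ifT//.
  by apply/mem_set; split => //; exact: set_mem.
rewrite integral0_eq// => y _; rewrite patchE ifF//.
by apply/negbTE; apply: contra xO => /set_mem[/=] ? _; exact/mem_set.
Qed.

(** The integrand is symmetric in its two variables, so the mirrored domain
    gives the same iterated integral. *)
Lemma integral_gagliardo_right u : measurable_fun setT u ->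
  (\int[mu \x mu]_(z in setT `*` Omega) gagliardo u z =
   \int[mu]_(x in Omega) \int[mu]_y gagliardo u (x, y))%E.
Proof.
move=> mf; rewrite integral_mkcond.
rewrite fubini_tonelli2; first last.
- by move=> z; rewrite patchE; case: ifP => // _; exact: gagliardo_ge0.
- apply/(measurable_restrictT _ _).1; first exact: measurableX.
  by apply: measurable_funTS; exact: measurable_gagliardo.
rewrite [RHS]integral_mkcond; apply: eq_integral => x _.
rewrite /fubini_G patchE; case: ifPn => xO.
  apply: eq_integral => y _; rewrite patchE ifT.
    by rewrite /gagliardo /= distrC nuC.
  by apply/mem_set; split => //; exact: set_mem.
rewrite integral0_eq// => y _; rewrite patchE ifF//.
by apply/negbTE; apply: contra xO => /set_mem[/=] _ ?; exact/mem_set.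
Qed.

(** By [psi_young] the integrand is dominated by the sum of the integrands of
    the two seminorms, and Tonelli's theorem turns these into the iterated
    integrals that are finite by membership in the space. *)
Lemma energy_fin_num u v : in_W p nu Omega u -> in_W p nu Omega v ->
  energy p nu Omega u v \is a fin_num.
Proof.
move=> [mu_ _ Wu] [mv _ Wv].
pose F z := (gagliardo u z + gagliardo v z)%E.
have F0 z : (0 <= F z)%E by rewrite adde_ge0// gagliardo_ge0.
have mF : measurable_fun setT F.
  by apply: emeasurable_funD; exact: measurable_gagliardo.
have mL : measurable (Omega `*` [set: Rn R d]) by exact: measurableX.
have mR : measurable ([set: Rn R d] `*` Omega) by exact: measurableX.
have finL : (\int[mu \x mu]_(z in Omega `*` setT) F z < +oo)%E.
  rewrite ge0_integralD//; try by [move=> z _; exact: gagliardo_ge0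
    | apply: measurable_funTS; exact: measurable_gagliardo].
  rewrite (integral_gagliardo_left _ mu_) (integral_gagliardo_left _ mv).
  by apply: lte_add_pinfty; [exact: Wu|exact: Wv].
have finR : (\int[mu \x mu]_(z in setT `*` Omega) F z < +oo)%E.
  rewrite ge0_integralD//; try by [move=> z _; exact: gagliardo_ge0
    | apply: measurable_funTS; exact: measurable_gagliardo].
  rewrite (integral_gagliardo_right _ mu_) (integral_gagliardo_right _ mv).
  by apply: lte_add_pinfty; [exact: Wu|exact: Wv].
rewrite /energy; set D := ~` _.
have mD : measurable D.
  by apply: measurableC; apply: measurableX; exact: measurableC.
have mN : measurable (~` Omega `*` Omega).
  by apply: measurableX => //; exact: measurableC.
(* the symmetric domain, split into disjoint parts *)
have DE : D = (Omega `*` setT) `|` (~` Omega `*` Omega).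
  apply/seteqP; split=> -[x y] /=.
    rewrite /D /= => /not_andP; rewrite !not_notE => xy.
    by have [xO|xO] := pselect (Omega x); [left|right; case: xy].
  by move=> [[xO _]|[_ yO]] [/= ? ?].
have mf : measurable_fun setT (fun z : Rn R d * Rn R d =>
    psi p (u z.1 - u z.2) * (v z.1 - v z.2) * nu (tsub z.1 z.2)).
  apply: measurable_funM; last exact: measurable_kernel.
  apply: measurable_funM; last exact: measurable_diff.
  apply: measurable_funM; last exact: measurable_diff.
  apply: (measurableT_comp (measurable_powR _)).
  by apply: (measurableT_comp (@normr_measurable _ _)); exact: measurable_diff.
rewrite fin_num_abs; apply: le_lt_trans; first apply: le_abse_integral => //.
  by apply: measurable_funTS; exact/measurable_EFinP.
apply: (@le_lt_trans _ _ (\int[mu \x mu]_(z in D) F z)%E).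
  apply: ge0_le_integral => //.
  - apply: measurable_funTS; apply/measurable_EFinP.
    by apply: (measurableT_comp (@normr_measurable _ _)).
  - exact: measurable_funTS.
  move=> z _; rewrite /F /gagliardo -EFinD lee_fin normrM -mulrDl.
  by rewrite [X in _ * X]ger0_norm// ler_wpM2r// psi_young.
rewrite DE ge0_integral_setU//; last 2 first.
- exact: measurable_funTS.
- by apply/disj_setPS => -[x y] /= [[] ? _ []].
apply: lte_add_pinfty => //; apply: le_lt_trans finR.
apply: ge0_subset_integral => //; first exact: measurable_funTS.
by move=> [x y] [].
Qed.

End energy_finite.

(** * The test function and the datum *)

Lemma decay_le1 (R : realType) (d : nat) (x s p : R) :
  1 <= x -> 0 < s -> 1 < p -> x `^ (- d%:R - s * p) <= 1.
Proof.
move=> x1 s0 p1; rewrite -[leRHS](powRr0 x) ler_powR// -opprD oppr_le0.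
by rewrite addr_ge0 ?ler0n ?mulr_ge0//; lra.
Qed.

(** The exponent 1 - q is negative, so an upper bound on the weight bounds its
    power from below. *)
Lemma weight_bounded_below (R : realType) (d : nat) (s p q : R)
    (w : Rn R d -> R) : 0 < s -> 1 < p -> 1 < q ->
  asymp w (fun h => (1 + enorm h) `^ (- d%:R - s * p)) ->
  exists2 k : R, 0 < k & forall y, k <= w y `^ (1 - q).
Proof.
move=> s0 p1 q1 [k [C [k0 C0 wP]]].
exists (C `^ (1 - q)) => [|y]; first exact: powR_gt0.
have n0 : 0 < 1 + enorm y by rewrite ltr_pwDl// sqrtr_ge0.
have n1 : (1 + enorm y) `^ (- d%:R - s * p) <= 1.
  by apply: decay_le1; rewrite ?lerDl ?sqrtr_ge0.
have /andP[lo hi] := wP y.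
have w0 : 0 < w y by apply: lt_le_trans lo; rewrite mulr_gt0// powR_gt0.
have wC : w y <= C by apply: (le_trans hi); rewrite ger_pMr.
rewrite -(opprB q 1) !powRN lef_pV2 ?posrE ?powR_gt0//.
by apply: ge0_ler_powR; rewrite ?nnegrE ?subr_ge0// ltW.
Qed.

Section counterexample.
Context {R : realType} {n : nat}.
Local Notation mu := (@lebesgue_Rn R n.+1).
Local Notation Omega := (@unit_ball R n.+1).

Lemma slab_sub_compl_ball (I : set R) :
  I `<=` `]2, +oo[ -> slab I `<=` ~` Omega.
Proof.
move=> I2 y [/I2 + _]; rewrite /= in_itv/= andbT => y2 yO.
have := enorm_ge_coord y ord0; move: yO; rewrite /unit_ball /= => yO.
rewrite -/(thead y) ger0_norm; lra.
Qed.

Lemma slab23_sub : slab `]2, 3]%classic `<=` ~` Omega.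
Proof.
by apply: slab_sub_compl_ball => t /=; rewrite !in_itv/= andbT => /andP[].
Qed.

Lemma singular_ball (a : R) x : Omega x -> singular a x = 0.
Proof. by move=> xO; apply: singular_out => /slab23_sub. Qed.

(** For x in the ball and y in the support, the first coordinates are more than
    1 apart, so the kernel is at most 1 and the inner integral of the seminorm
    is bounded by the integral of the p-th power, uniformly in x. *)
Lemma in_W_singular (p s a : R) : 1 < p -> 0 < s -> 0 <= a * p < 1 ->
  in_W p (frac_kernel s p) Omega (singular a).
Proof.
move=> p1 s0 ap1; have p_neq0 : p != 0 by rewrite gt_eqF//; lra.
have mO := @measurable_unit_ball R n.+1.
have fin_p : (\int[mu]_y (singular (a * p) y)%:E < +oo)%E.
  exact: integral_singular_lty.
split.
- exact: measurable_singular.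
- rewrite integral0_eq// => x xO.
  by rewrite singular_ball// normr0 powR0.
pose G := gagliardo p (frac_kernel s p) (@singular R n a).
have mG : measurable_fun setT G.
  by apply: measurable_gagliardo; [exact: measurable_frac_kernel
    | exact: measurable_singular].
have G0 z : (0 <= G z)%E by apply: gagliardo_ge0; exact: frac_kernel_ge0.
(* naming the inner integral gives access to its measurability in x *)
change (\int[mu]_(x in Omega) fubini_F mu G x < +oo)%E.
pose M := (\int[mu]_y (singular (a * p) y)%:E)%E.
apply: (@le_lt_trans _ _ (\int[mu]_(x in Omega) (cst M) x)%E); last first.
  rewrite integral_cst// lte_mul_pinfty//.
  - by apply: integral_ge0 => y _; rewrite lee_fin singular_ge0.
  - rewrite ge0_fin_numE//.
    by apply: integral_ge0 => y _; rewrite lee_fin singular_ge0.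
  - exact: lebesgue_unit_ball_lty.
apply: ge0_le_integral.
- exact: mO.
- by move=> x _; apply: integral_ge0 => y _; exact: G0.
- by apply: measurable_funTS; exact: measurable_fun_fubini_tonelli_F.
- by [].
move=> x xO; apply: ge0_le_integral.
- by [].
- by move=> y _; exact: G0.
- exact: (measurableT_comp mG (pair1_measurable _)).
- by apply/measurable_EFinP; exact: measurable_singular.
move=> y _; rewrite lee_fin (singular_ball a x xO) sub0r normrN.
rewrite ger0_norm ?singular_ge0// singular_powR//.
have [yS|yS] := pselect (slab `]2, 3]%classic y); last first.
  by rewrite singular_out// mul0r.
rewrite -[leRHS]mulr1 ler_wpM2l ?singular_ge0//.
have far : 1 <= enorm (tsub x y).
  have := enorm_ge_coord (tsub x y) ord0; rewrite tnth_mktuple.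
  have := enorm_ge_coord x ord0; case: yS => + _; move: xO.
  rewrite /unit_ball /= in_itv/= /thead => x1 /andP[y2 _].
  by rewrite !ler_norml => /andP[] ? ? /andP[]; lra.
exact: decay_le1.
Qed.

End counterexample.

Theorem theorem8p14 (R : realType) (d : nat) (p s : R)
    (nut : Rn R d -> R)
    (d_gt0 : (0 < d)%N) (p_gt1 : 1 < p) (s01 : 0 < s < 1)
    (mnut : measurable_fun [set: Rn R d] nut)
    (nut_asymp : asymp nut (fun h => (1 + enorm h) `^ (- d%:R - s * p))) :
  let Omega : set (Rn R d) := unit_ball in
  let p' := conjugate_exponent p in
  exists g : Rn R d -> R,
    [/\ (lebesgue_Rn d).-integrable (~` Omega) (EFin \o g),
        ~ in_Lq p' (~` Omega) (fun y => nut y `^ (1 - p')) g,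
        (\int[lebesgue_Rn d]_(y in ~` Omega) (g y)%:E = 0)%E &
        ~ exists u : Rn R d -> R,
            neumann_weak_solution p (frac_kernel s p) Omega g u].
Proof.
case: d d_gt0 nut mnut nut_asymp => // n _ nut mnut nut_asymp Omega p'.
have [s0 _] := andP s01.
have mO : measurable (~` Omega).
  by apply: measurableC; exact: measurable_unit_ball.
have AO : slab `]2, 3]%classic `<=` ~` Omega by exact: slab23_sub.
pose mu := @lebesgue_Rn R n.+1.
(* a p = 1/2 makes the p-th power of the test function integrable *)
pose a := (2 * p)^-1; pose b := 1 - a.
have ap : a * p = 2^-1 by rewrite /a; field; lra.
have a01 : 0 < a < 1.
  rewrite invr_gt0 invf_lt1; lra.
pose h := @singular R n b.
(* the mean of h is compensated on a box disjoint from its support *)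
pose B : set (Rn R n.+1) := slab `]3, 4]%classic.
have mB : measurable B by apply: measurable_slab; exact: measurable_itv.
have BO : B `<=` ~` Omega.
  by apply: slab_sub_compl_ball => t /=; rewrite !in_itv/= andbT; lra.
have B_A y : B y -> ~ slab `]2, 3]%classic y.
  by move=> [+ _] [+ _]; rewrite /= !in_itv/=; lra.
have muB : mu B = 1%E.
  rewrite /mu lebesgue_slab ?lebesgue_measure_itv /=;
    last exact: measurable_itv.
  rewrite lte_fin ifT; last by lra.
  by congr EFin; lra.
have h_lty : (\int[mu]_(y in ~` Omega) (h y)%:E < +oo)%E.
  by apply: integral_singular_lty => //; rewrite /b; lra.
have ih : mu.-integrable (~` Omega) (EFin \o h).
  apply/integrableP; split.
    by apply/measurable_EFinP; exact: measurable_singular.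
  under eq_integral do rewrite /= ger0_norm ?singular_ge0//.
  exact: h_lty.
have h_fin : (\int[mu]_(y in ~` Omega) (h y)%:E)%E \is a fin_num.
  rewrite ge0_fin_numE//.
  by apply: integral_ge0 => y _; rewrite lee_fin singular_ge0.
pose c := fine (\int[mu]_(y in ~` Omega) (h y)%:E)%E.
have c0 : 0 <= c.
  by apply: fine_ge0; apply: integral_ge0 => y _; rewrite lee_fin singular_ge0.
have mcB : measurable_fun (~` Omega) (fun y => c * \1_B y).
  by apply: measurable_funM => //; exact: measurable_indic.
have intB : (\int[mu]_(y in ~` Omega) (c * \1_B y)%:E)%E = c%:E.
  under eq_integral do rewrite EFinM.
  rewrite ge0_integralZl//; last first.
    by apply/measurable_EFinP; exact: measurable_indic.
  by rewrite integral_indic// (setIidl BO) [X in (_ * X)%E]muB mule1.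
have iB : mu.-integrable (~` Omega) (fun y => (c * \1_B y)%:E).
  apply/integrableP; split; first exact/measurable_EFinP.
  under eq_integral do rewrite /= ger0_norm ?mulr_ge0//.
  by rewrite intB ltry.
pose g y := h y - c * \1_B y.
have gE y : slab `]2, 3]%classic y -> g y = h y.
  move=> yA; rewrite /g indicE memNset ?mulr0 ?subr0// => yB; exact: B_A yA.
exists g; split.
- rewrite (_ : _ \o _ =
      (EFin \o h) \- (fun y => (c * \1_B y)%:E))%E; last first.
    by apply/funext => y; rewrite /= -EFinB.
  exact: integrableB.
- move=> [mg]; apply/negP; rewrite -leNgt.
  have bp'_ge1 : 1 <= b * p'.
    have -> : b * p' = 1 + 2^-1 / (p - 1).
      by rewrite /b /p' /conjugate_exponent /a; field; lra.
    by rewrite lerDl divr_ge0//; lra.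
  have p'1 : 1 < p'.
    have -> : p' = 1 + 1 / (p - 1).
      by rewrite /p' /conjugate_exponent; field; lra.
    by rewrite ltrDl divr_gt0//; lra.
  have [k k0 nutk] :=
    weight_bounded_below _ _ _ _ _ _ s0 p_gt1 p'1 nut_asymp.
  have <- : (\int[mu]_(y in ~` Omega) (k * singular 1 y)%:E = +oo)%E.
    under eq_integral do rewrite EFinM.
    rewrite ge0_integralZl//.
    - by rewrite integral_singular1// gt0_muley ?lte_fin.
    - by apply/measurable_EFinP; exact: measurable_singular.
    - by move=> y _; rewrite lee_fin singular_ge0.
    - by rewrite lee_fin ltW.
  apply: ge0_le_integral => //.
  - by move=> y _; rewrite lee_fin mulr_ge0 ?singular_ge0 ?ltW.
  - apply/measurable_EFinP; apply: measurable_funM => //.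
    exact: measurable_singular.
  - apply/measurable_EFinP; apply: measurable_funM.
      apply: (measurableT_comp (measurable_powR _)).
      exact: (measurableT_comp (@normr_measurable _ _)).
    by apply: measurable_funTS; exact: (measurableT_comp (measurable_powR _)).
  move=> y _; rewrite lee_fin mulrC.
  have [yA|yA] := pselect (slab `]2, 3]%classic y); last first.
    by rewrite singular_out// mul0r mulr_ge0// powR_ge0.
  rewrite gE// ger0_norm ?singular_ge0// singular_powR; last first.
    by rewrite gt_eqF//; lra.
  apply: ler_pM; rewrite ?singular_ge0 ?(ltW k0)//.
  exact: le_singular.
- under eq_integral do rewrite /g EFinB.
  rewrite integralB//= intB.
  by rewrite /c fineK// subee.
move=> [u [Wu /(_ (singular a))]].
have Wv : in_W p (frac_kernel s p) Omega (singular a).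
  by apply: in_W_singular => //; rewrite ap; lra.
move=> /(_ Wv) eq_energy.
have := @energy_fin_num R n.+1 p (frac_kernel s p) Omega p_gt1
  (measurable_frac_kernel _ _) (frac_kernel_ge0 _ _) _ measurable_unit_ball
  _ _ Wu Wv.
(* g v has the critical exponent b + a = 1 *)
rewrite eq_energy; under eq_integral => y _.
  rewrite (_ : g y * _ = singular 1 y); first over.
  have [yA|yA] := pselect (slab `]2, 3]%classic y); last first.
    by rewrite !singular_out// mulr0.
  by rewrite gE// /h singularM subrK.
rewrite integral_singular1// => /(_ _)-/(_ _)/negP; apply => // x y.
by rewrite /frac_kernel enorm_tsubC.
Qed.
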